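(* Let $(X,T)$ be a topological space and let $(\widehat X,\widehat T)$ be the nonstandard $\Phi$-hull of $(X,T)$ for $\Phi=C_b(X,\mathbb R)$, with quotient map $q:{}^*X\to\widehat X$. Then $(\widehat X,\widehat T)$ (together with the map $q|_X:X\to\widehat X$) coincides with the Stone–Čech compactification $\beta X$ of $(X,T)$.
   Context: Nonstandard setting. Let $S\supseteq X\cup\mathbb R$ be a set of individuals, with superstructure $V(S)=\bigcup_{k\ge 0}V_k(S)$, $V_0(S)=S$, $V_{k+1}(S)=V_k(S)\cup\mathcal P(V_k(S))$. A $\kappa$-saturated nonstandard model of $S$ is a superstructure $V({}^*S)$ with a map $A\mapsto {}^*A$ from $V(S)$ into $V({}^*S)$ satisfying: (Extension) ${}^*s=s$ for all $s\in S$; (Transfer) a bounded quantifier formula $\Psi(A_1,\dots,A_n)$ with constants in $V(S)$ is true iff $\Psi({}^*A_1,\dots,{}^*A_n)$ is true in $V({}^*S)$; (Saturation) every family of at most $\kappa$ internal sets with the finite intersection property has nonempty intersection. An entity of $V({}^*S)$ is internal if it is an element of ${}^*A$ for some $A\in V(S)$. Throughout, a $\kappa$-saturated model with $\kappa$ infinite and $\kappa>\operatorname{card}T$ is fixed; $X\subseteq {}^*X$. The standard topology ${}^sT$ on ${}^*X$ has base $\{{}^*G:G\in T\}$. $C_b(X,\mathbb R)$ is the set of continuous bounded real-valued functions on $(X,T)$. In ${}^*\mathbb R$, $\xi\approx\eta$ means $|\xi-\eta|<1/n$ for all $n\in\mathbb N$. For $\Phi=C_b(X,\mathbb R)$ the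 nonstandard $\Phi$-hull is $\widehat X={}^*X/\!\sim$, where $\alpha\sim\beta$ iff ${}^*f(\alpha)\approx{}^*f(\beta)$ for all $f\in C_b(X,\mathbb R)$, with the quotient topology $\widehat T$ of ${}^sT$. The Stone–Čech compactification of an arbitrary topological space $(X,T)$ is characterized (up to homeomorphism compatible with the maps from $X$) as a compact Hausdorff space $K$ with a continuous map $e:X\to K$ with dense image such that every $f\in C_b(X,\mathbb R)$ has a unique continuous extension $\widehat f:K\to\mathbb R$, i.e. $\widehat f\circ e=f$. *)

(* Defs.v *)
From HB Require Import structures.
From mathcomp Require Import all_boot all_order all_algebra.
From mathcomp Require Import all_classical all_reals all_analysis.

Set Implicit Arguments.
Unset Strict Implicit.
Unset Printing Implicit Defensive.

Import Order.TTheory GRing.Theory Num.Theory.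
Import numFieldNormedType.Exports.

Local Open Scope classical_set_scope.
Local Open Scope card_scope.
Local Open Scope ring_scope.

(** * Superstructures *)

Section Levels.
Context (S E : Type) (mem : E -> E -> Prop) (ind : S -> E).

Definition is_set_of (A : E) := ~ range ind A.

Definition members_of (A : E) : set E := [set a | mem a A].

(** V_0 = S and V_(k+1) = V_k `|` P(V_k). *)
Fixpoint level_of (k : nat) : set E :=
  if k is k'.+1 then
    level_of k' `|` [set A | is_set_of A /\ members_of A `<=` level_of k']
  else range ind.

End Levels.

(** [superstructure S] presents V(S) = \bigcup_k V_k(S) by its entities, their
    membership relation [mem a A] (a belongs to A) and the inclusion [ind] of
    the individuals, which are memberless atoms different from the empty set.
    The fields determine V(S) up to a unique isomorphism over S. *)
Record superstructure (S : Type) := Superstructure {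
  entity :> Type;
  mem : entity -> entity -> Prop;
  ind : S -> entity;
  ind_inj : injective ind;
  mem_ind : forall a s, ~ mem a (ind s);
  set_ext : forall A B, is_set_of ind A -> is_set_of ind B ->
    members_of mem A = members_of mem B -> A = B;
  level_cover : forall a, exists k, level_of mem ind k a;
  level_powerset : forall k (B : set entity), B `<=` level_of mem ind k ->
    exists A, is_set_of ind A /\ members_of mem A = B }.

Arguments mem {S V} : rename.
Arguments ind {S} V : rename.

Section SuperstructureTheory.
Context (S : Type) (V : superstructure S).

Definition is_set (A : V) := is_set_of (ind V) A.

Definition members (A : V) : set V := members_of mem A.

Definition level (k : nat) : set V := level_of mem (ind V) k.

Lemma setof_subproof (B : set V) : exists A : V,
  (exists k, B `<=` level k) -> is_set A /\ members A = B.
Proof.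
have [[k Bk]|nB] := pselect (exists k, B `<=` level k).
  by have [A ?] := level_powerset Bk; exists A.
have [A _] := @level_powerset _ V 0 set0 (@sub0set _ _).
by exists A => /nB.
Qed.

(** The element of V(S) whose members are those of [B]; meaningful only when
    [B] is included in some level. *)
Definition setof (B : set V) : V := projT1 (cid (setof_subproof B)).

Lemma setofP (B : set V) k : B `<=` level k ->
  is_set (setof B) /\ members (setof B) = B.
Proof. by move=> Bk; apply: (projT2 (cid (setof_subproof B))); exists k. Qed.

(** Kuratowski pairs. *)
Definition opair (a b : V) : V := setof [set setof [set a]; setof [set a; b]].

(** The graph of [f], along interpretations of its domain and codomain. *)
Definition fgraph (A B : Type) (i : A -> V) (j : B -> V) (f : A -> B) : V :=
  setof [set opair (i x) (j (f x)) | x in [set: A]].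

Lemma app_subproof (F a : V) : exists b : V,
  (exists c, mem (opair a c) F) -> mem (opair a b) F.
Proof.
have [[b Fb]|nF] := pselect (exists c, mem (opair a c) F); first by exists b.
by exists a => /nF.
Qed.

(** The value at [a] of the function with graph [F]. *)
Definition app (F a : V) : V := projT1 (cid (app_subproof F a)).

End SuperstructureTheory.

(** * Bounded quantifier formulas *)

(** Variables are de Bruijn indices; in [FAll i phi] and [FEx i phi] the bound
    [i] is read outside the quantifier, and index 0 of [phi] is the variable
    ranging over the members of [i]. *)
Inductive formula : Type :=
| FEq of nat & nat
| FMem of nat & nat
| FNot of formula
| FAnd of formula & formula
| FOr of formula & formula
| FImp of formula & formula
| FAll of nat & formula
| FEx of nat & formula.

Definition scons (T : Type) (x : T) (e : nat -> T) (i : nat) : T :=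
  if i is j.+1 then e j else x.

Fixpoint sat (S : Type) (V : superstructure S) (e : nat -> V) (phi : formula)
    : Prop :=
  match phi with
  | FEq i j => e i = e j
  | FMem i j => mem (e i) (e j)
  | FNot p => ~ sat e p
  | FAnd p q => sat e p /\ sat e q
  | FOr p q => sat e p \/ sat e q
  | FImp p q => sat e p -> sat e q
  | FAll i p => forall x : V, mem x (e i) -> sat (scons x e) p
  | FEx i p => exists x : V, mem x (e i) /\ sat (scons x e) p
  end.

(** * Nonstandard models *)

Definition internal (S S' : Type) (V : superstructure S)
    (V' : superstructure S') (star : V -> V') (a : V') : Prop :=
  exists A : V, mem a (star A).

(** The cardinal kappa is that of the type [K]. The constants A_1, ..., A_n of
    a formula are the values of the valuation [e]. The map [starS_incl] stands
    for the inclusion of S in *S; its injectivity follows from [transfer]. *)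
Record nonstandard_model (S : Type) (V : superstructure S) (K : Type) :=
  NonstandardModel {
  starS : Type;
  starV : superstructure starS;
  star : V -> starV;
  starS_incl : S -> starS;
  starSE : members (star (setof (range (ind V)))) = range (ind starV);
  extension : forall s, star (ind V s) = ind starV (starS_incl s);
  transfer : forall (phi : formula) (e : nat -> V),
    sat e phi <-> sat (star \o e) phi;
  saturation : forall F : set starV,
    F #<= [set: K] ->
    (forall A, F A -> is_set A /\ internal star A) ->
    (forall G, G `<=` F -> finite_set G ->
       \bigcap_(A in G) members A !=set0) ->
    \bigcap_(A in F) members A !=set0 }.

Arguments starV {S V K}.
Arguments star {S V K}.

(** * The standard topology and the hull *)

(** A set of individuals containing X and R, which may overlap. *)
Record individuals (X R : Type) := Individuals {
  indiv :> Type;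
  inX : X -> indiv;
  inR : R -> indiv;
  inX_inj : injective inX;
  inR_inj : injective inR }.

Arguments inX {X R} S : rename.
Arguments inR {X R} S : rename.

Section Hull.
Context (R : realType) (X : topologicalType) (S : individuals X R).
Context (V : superstructure S) (K : Type) (M : nonstandard_model V K).

Definition ptX (x : X) : V := ind V (inX S x).

Definition ptR (r : R) : V := ind V (inR S r).

Definition subX (G : set X) : V := setof (ptX @` G).

Lemma mem_subX (G : set X) (a : V) : mem a (subX G) <-> (ptX @` G) a.
Proof.
have [|_ GE] := @setofP _ V (ptX @` G) 0; last by rewrite -GE.
by move=> _ [x _ <-]; exists (inX S x).
Qed.

Definition starX : Type := set_type (members (star M (subX [set: X]))).

HB.instance Definition _ := gen_eqMixin starX.
HB.instance Definition _ := gen_choiceMixin starX.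

(** The trace of *G on *X, for G a subset of X. *)
Definition star_sub (G : set X) : set starX :=
  [set a | mem (set_val a) (star M (subX G))].

Lemma star_subT : star_sub [set: X] = [set: starX].
Proof. by rewrite -subTset => a _; exact: set_mem (valP a). Qed.

Lemma star_subI (G H : set X) :
  star_sub (G `&` H) = star_sub G `&` star_sub H.
Proof.
pose e i : V := nth (subX (G `&` H)) [:: subX G; subX H] i.
pose phi := FAnd (FAll 2 (FAnd (FMem 0 1) (FMem 0 2)))
                 (FAll 0 (FImp (FMem 0 2) (FMem 0 3))).
have /(transfer M)[/= sub1 sub2] : sat e phi.
  split=> /= a; rewrite !mem_subX /=.
    by move=> [x [Gx Hx] <-]; split; exists x.
  move=> [x Gx <-] [y Hy xy]; have yx := inX_inj (ind_inj xy).
  by exists x => //; split=> //; rewrite -yx.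
by apply/seteqP; split=> a /= => [/sub1//|[Ga Ha]]; exact: sub2.
Qed.

Lemma star_sub_join (G H : set X) (a : starX) : open G -> open H ->
  star_sub G a -> star_sub H a ->
  exists I,
    [/\ open I, star_sub I a & star_sub I `<=` star_sub G `&` star_sub H].
Proof.
move=> oG oH aG aH; exists (G `&` H); rewrite star_subI.
by split=> //; exact: openI.
Qed.

Lemma star_sub_cover : \bigcup_(G in @open X) star_sub G = [set: starX].
Proof. by rewrite -subTset -star_subT; apply: bigcup_sup; exact: openT. Qed.

(** The standard topology: the sets *G, for G open in X, form a base. *)
HB.instance Definition _ :=
  isBaseTopological.Build starX star_sub_cover star_sub_join.

Lemma embX_subproof (x : X) :
  star M (ptX x) \in members (star M (subX [set: X])).
Proof.
apply/mem_set/(transfer M (FMem 0 1) (scons (ptX x) (fun=> subX [set: X]))).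
by rewrite /= mem_subX; exists x.
Qed.

(** The inclusion of X in *X. *)
Definition embX (x : X) : starX := exist _ (star M (ptX x)) (embX_subproof x).

(** *f(a), for a in *X. *)
Definition star_fun (f : X -> R) (a : starX) : starV M :=
  app (star M (fgraph ptX ptR f)) (set_val a).

Definition graph_sub : V :=
  fgraph (fun rs : R * R => opair (ptR rs.1) (ptR rs.2)) ptR
         (fun rs => rs.1 - rs.2).

Definition graph_abs : V := fgraph ptR ptR (fun r => `|r|).

Definition graph_lt : V :=
  setof [set opair (ptR rs.1) (ptR rs.2) |
         rs in [set rs : R * R | rs.1 < rs.2]].

(** |xi - eta| < 1/n in *R for every standard n >= 1. *)
Definition infinitely_close (xi eta : starV M) : Prop :=
  forall n : nat, (0 < n)%N ->
  mem (opair (app (star M graph_abs) (app (star M graph_sub) (opair xi eta)))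
             (star M (ptR n%:R^-1)))
      (star M graph_lt).

Definition hull_rel (Phi : set (X -> R)) (a b : starX) : Prop :=
  forall f, Phi f -> infinitely_close (star_fun f a) (star_fun f b).

(** *X/~ as the set of the classes [set b | a ~ b], which the quotient
    structure below equips with the projection a |-> [set b | a ~ b]. *)
Definition hull_set (Phi : set (X -> R)) : Type :=
  {C : set starX | exists a, C = hull_rel Phi a}.

Definition hull_pi (Phi : set (X -> R)) (a : starX) : hull_set Phi :=
  exist _ (hull_rel Phi a) (ex_intro _ a erefl).

Definition hull_repr (Phi : set (X -> R)) (C : hull_set Phi) : starX :=
  projT1 (cid (projT2 C)).

Lemma hull_reprK (Phi : set (X -> R)) : cancel (@hull_repr Phi) (hull_pi Phi).
Proof.
move=> [C aC]; rewrite /hull_repr; case: cid => a /= Ca.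
exact/esym/eq_exist.
Qed.

HB.instance Definition _ (Phi : set (X -> R)) :=
  isQuotient.Build starX (hull_set Phi) (@hull_reprK Phi).

Definition hull (Phi : set (X -> R)) : topologicalType :=
  quotient_topology (hull_set Phi).

Definition hull_map (Phi : set (X -> R)) : starX -> hull Phi :=
  \pi_(hull_set Phi)%qT.

End Hull.

(** * The Stone-Cech compactification *)

Definition Cb (R : realType) (X : topologicalType) : set (X -> R) :=
  [set f | continuous f /\ bounded_fun f].

Arguments Cb : clear implicits.

(** [e : X -> K] is the Stone-Cech compactification of X, which this universal
    property determines up to a unique homeomorphism compatible with [e]. *)
Definition stone_cech (R : realType) (X K : topologicalType) (e : X -> K) :
    Prop :=
  [/\ compact [set: K], hausdorff_space K, continuous e, dense (range e) &
      forall f, Cb R X f -> exists! g : K -> R, continuous g /\ g \o e = f].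

(* Main.v *)
Require Import Defs.
From mathcomp Require Import all_boot all_order all_algebra.
From mathcomp Require Import all_classical all_reals all_analysis.
From mathcomp Require Import lra.

(** A point a of *X is seen through the filter of the subsets A of X with a in
    *A, which is an ultrafilter by transfer. For f bounded the standard part of
    *f(a) is the limit of f along it, so a ~ b if and only if these limits
    agree for every f in Cb(X). This limit is a continuous function of a
    for the standard topology, hence induces the extension of f to the hull,
    and these extensions separate the points of the hull. Compactness is that
    of *X: for a filter F on *X, saturation applies to the internal sets
    *(X \ G) in F with G open, and a point of all of them is a cluster point of
    F. The density of X is the fact that *G is empty only if G is. *)

Set Implicit Arguments.
Unset Strict Implicit.
Unset Printing Implicit Defensive.

Import Order.TTheory GRing.Theory Num.Theory.
Import numFieldNormedType.Exports.

Local Open Scope classical_set_scope.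
Local Open Scope card_scope.
Local Open Scope ring_scope.

Local Notation mem := Defs.mem.
Local Notation fgraph := Defs.fgraph.

(** * Finite intersections in filters, and maps that agree on a dense set *)

Lemma filter_finite_bigcap (T I : Type) (D : set I) (f : I -> set T)
    (F : set_system T) : Filter F -> finite_set D ->
  (forall i, D i -> F (f i)) -> F (\bigcap_(i in D) f i).
Proof.
elim/Pchoice: I => I in D f * => FF /finite_fsetP[D' ->].
exact: filter_bigI.
Qed.

Lemma dense_continuous_eq (T U : topologicalType) (D : set T) (g h : T -> U) :
  hausdorff_space U -> dense D -> continuous g -> continuous h ->
  (forall x, D x -> g x = h x) -> g = h.
Proof.
move=> hausU dD gc hc geqh; apply/funext => y; apply: hausU => A B gA hB.
have : nbhs y ((g @^-1` A) `&` (h @^-1` B)).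
  by apply: filterI; [exact: gc|exact: hc].
rewrite nbhsE => -[N [oN Ny] NAB].
have [x [/NAB[/= Ax Bx] Dx]] := dD N (ex_intro _ y Ny) oN.
by exists (g x); split=> //; rewrite geqh.
Qed.

(** * Sets and Kuratowski pairs in a superstructure *)

Section Pairs.
Context (S : Type) (V : superstructure S).
Implicit Types a b c d p w : V.

Lemma level_le k l : (k <= l)%N -> (level k : set V) `<=` level l.
Proof.
move=> /subnK <-; elim: (l - k)%N => [|m IH] a ak; first by [].
by rewrite addSn; left; exact: IH.
Qed.

Lemma level_pair a b : exists k, [set a; b] `<=` level k.
Proof.
have [[k ak] [l bl]] := (level_cover a, level_cover b).
exists (maxn k l) => c [] ->.
  exact: level_le (leq_maxl _ _) _ ak.
exact: level_le (leq_maxr _ _) _ bl.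
Qed.

Lemma mem_is_set a b : mem a b -> is_set b.
Proof. by move=> ab [s _ sb]; apply: (@mem_ind _ V a s); rewrite sb. Qed.

(** Individuals have no members, so the member [a] shows that [A] and [B] are sets, to which
    extensionality applies. *)
Lemma mem_set_ext a A B : mem a A -> members A = members B -> A = B.
Proof.
move=> aA AB; apply: (set_ext _ _ AB); first exact: mem_is_set aA.
by apply: (@mem_is_set a); rewrite -[mem _ _]/(members B a) -AB.
Qed.

Lemma mem_setof (B : set V) k a : B `<=` level k -> mem a (setof B) <-> B a.
Proof.
by move=> Bk; have [_ BE] := setofP Bk; rewrite -[mem _ _]/(members _ a) BE.
Qed.

Lemma mem_setof2 a b c : mem c (setof [set a; b]) <-> c = a \/ c = b.
Proof. by have [k abk] := level_pair a b; rewrite (mem_setof _ abk). Qed.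

Lemma mem_setof1 a c : mem c (setof [set a]) <-> c = a.
Proof. by rewrite -(setUid [set a]) mem_setof2; split=> [[]|]; auto. Qed.

(** The right-hand side uses only membership, equality and a quantifier bounded by [w], so a bounded
    formula can express it; likewise in [setof2P]. *)
Lemma setof1P w a :
  w = setof [set a] <-> mem a w /\ forall c, mem c w -> c = a.
Proof.
split=> [->|[aw wa]]; first by split=> [|c /mem_setof1//]; exact/mem_setof1.
apply: (mem_set_ext aw); apply/seteqP; split=> c;
  rewrite /members /members_of /= mem_setof1.
  exact: wa.
by move=> ->.
Qed.

Lemma setof2P w a b :
  w = setof [set a; b] <->
  mem a w /\ mem b w /\ forall c, mem c w -> c = a \/ c = b.
Proof.
split=> [->|[aw [bw wab]]].
  by split; [|split=> [|c]]; rewrite ?mem_setof2; auto.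
apply: (mem_set_ext aw); apply/seteqP; split=> c;
  rewrite /members /members_of /= mem_setof2.
  exact: wab.
by case=> ->.
Qed.

Lemma opair_inj a b c d : opair a b = opair c d -> a = c /\ b = d.
Proof.
move=> abcd.
have mE w : (w = setof [set a] \/ w = setof [set a; b]) <->
            (w = setof [set c] \/ w = setof [set c; d]).
  by rewrite -!mem_setof2 -/(opair a b) abcd.
have ac : a = c.
  (* {a} is {c} or {c, d}, and c belongs to it in either case. *)
  have [/(_ (or_introl erefl)) + _] := mE (setof [set a]).
  case=> h; apply/esym/mem_setof1; rewrite h ?mem_setof1 ?mem_setof2; auto.
split=> //; subst c.
have [/(_ (or_intror erefl)) hb _] := mE (setof [set a; b]).
have [_ /(_ (or_intror erefl)) hd] := mE (setof [set a; d]).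
have bE : b = a \/ b = d.
  have : mem b (setof [set a; b]) by rewrite mem_setof2; right.
  by case: hb => ->; rewrite ?mem_setof1 ?mem_setof2; auto.
have dE : d = a \/ d = b.
  have : mem d (setof [set a; d]) by rewrite mem_setof2; right.
  by case: hd => ->; rewrite ?mem_setof1 ?mem_setof2; auto.
by case: bE dE => [->|->//] [].
Qed.

Lemma level_setof (B : set V) k : B `<=` level k -> level k.+1 (setof B).
Proof.
move=> Bk; have [sB BE] := setofP Bk; right; split=> //.
by rewrite -[members_of _ _]/(members (setof B)) BE.
Qed.

(** Each of the two nested braces in {{a}, {a, b}} costs one level. *)
Lemma level_opair a b k :
  level k a -> level k b -> level k.+2 (opair a b).
Proof.
move=> ak bk.
have sub1 : [set a] `<=` level k by move=> _ ->.
have sub2 : [set a; b] `<=` level k by move=> _ [->|->].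
have sub3 : [set setof [set a]; setof [set a; b]] `<=` level k.+1.
  by move=> _ [->|->]; exact: level_setof.
exact: level_setof.
Qed.

Lemma mem_fgraph (A B : Type) (i : A -> V) (j : B -> V) (f : A -> B) k l a :
  range i `<=` level k -> range j `<=` level l ->
  mem a (fgraph i j f) <-> exists x, opair (i x) (j (f x)) = a.
Proof.
move=> ik jl; rewrite (@mem_setof _ (maxn k l).+2).
  by split=> [[x _ <-]|[x <-]]; exists x.
move=> _ [x _ <-]; apply: level_opair.
  by apply: level_le (leq_maxl _ _) _ (ik _ _); exists x.
by apply: level_le (leq_maxr _ _) _ (jl _ _); exists (f x).
Qed.

End Pairs.

(** * Bounded formulas about pairs *)

(* The formulas for pairs are opaque, for [/=] would expand [sat] through
   them. *)
Lemma fpair_subproof : {phi : nat -> nat -> nat -> formula |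
  forall (S : Type) (V : superstructure S) (e : nat -> V) p a b,
  sat e (phi p a b) <-> e p = opair (e a) (e b)}.
Proof.
pose sing w a := FAnd (FMem a w) (FAll w (FEq 0 a.+1)).
pose doub w a b := FAnd (FMem a w)
  (FAnd (FMem b w) (FAll w (FOr (FEq 0 a.+1) (FEq 0 b.+1)))).
(* Some member of p is {a}, some member is {a, b}, and every member is one of these. Free indices
   grow by one under each quantifier. *)
exists (fun p a b => FAnd (FEx p (sing 0 a.+1)) (FAnd (FEx p (doub 0 a.+1 b.+1))
  (FAll p (FOr (sing 0 a.+1) (doub 0 a.+1 b.+1))))) => S V e p a b.
rewrite setof2P /=.
split=> [[[w [wp /setof1P wE]] [[w' [wp' /setof2P wE']] pE]]|[ap [abp pE]]].
  subst w w'; do 2!split=> //.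
  by move=> c /pE; rewrite -setof1P -setof2P.
split; first by exists (setof [set e a]); rewrite -setof1P.
split; first by exists (setof [set e a; e b]); rewrite -setof2P.
by move=> c /pE; rewrite -setof1P -setof2P.
Qed.

Definition fpair : nat -> nat -> nat -> formula := sval fpair_subproof.

Lemma sat_fpair (S : Type) (V : superstructure S) (e : nat -> V) p a b :
  sat e (fpair p a b) <-> e p = opair (e a) (e b).
Proof. exact: (svalP fpair_subproof). Qed.

Lemma fpair_mem_subproof : {phi : nat -> nat -> nat -> formula |
  forall (S : Type) (V : superstructure S) (e : nat -> V) a b F,
  sat e (phi a b F) <-> mem (opair (e a) (e b)) (e F)}.
Proof.
exists (fun a b F => FEx F (fpair 0 a.+1 b.+1)) => S V e a b F.
split=> /= [[p [pF]]|abF]; first by rewrite sat_fpair /= => <-.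
by exists (opair (e a) (e b)); rewrite sat_fpair.
Qed.

Definition fpair_mem : nat -> nat -> nat -> formula := sval fpair_mem_subproof.

Lemma sat_fpair_mem (S : Type) (V : superstructure S) (e : nat -> V) a b F :
  sat e (fpair_mem a b F) <-> mem (opair (e a) (e b)) (e F).
Proof. exact: (svalP fpair_mem_subproof). Qed.

(** * First consequences of transfer *)

Section StarTheory.
Context (S : Type) (V : superstructure S) (K : Type).
Context (M : nonstandard_model V K).

Lemma star_mem (a A : V) : mem (star M a) (star M A) <-> mem a A.
Proof. exact: iff_sym (transfer M (FMem 0 1) (scons a (fun=> A))). Qed.

(** By [starSE] the individuals of [starV M] are the members of *S, so the statement that A is not
    in S transfers. *)
Lemma star_is_set (A : V) : is_set A -> is_set (star M A).
Proof.
move=> As; rewrite /is_set /is_set_of -(starSE M) /members /members_of /=.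
by rewrite star_mem (@mem_setof _ _ _ 0).
Qed.

Lemma star_internal (A : V) : internal (star M) (star M A).
Proof. by exists (setof [set A]); rewrite star_mem mem_setof1. Qed.

Lemma star_app_fgraph (A B : Type) (i : A -> V) (j : B -> V) (f : A -> B)
    k l a :
  range i `<=` level k -> range j `<=` level l ->
  mem a (star M (setof (range i))) ->
  let b := app (star M (fgraph i j f)) a in
  mem b (star M (setof (range j))) /\ mem (opair a b) (star M (fgraph i j f)).
Proof.
move=> ik jl aD /=.
pose e n : V := nth (setof (range i)) [:: setof (range i); setof (range j);
  fgraph i j f] n.
(* [app] is a choice with an arbitrary default; it lies on the graph as soon as some value does,
   which totality provides. *)
have ex b : mem (opair a b) (star M (fgraph i j f)) ->
    mem (opair a (app (star M (fgraph i j f)) a)) (star M (fgraph i j f)).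
  by rewrite /app; case: cid => c /= h ab; apply: h; exists b.
have /(transfer M)/= tot : sat e (FAll 0 (FEx 2 (fpair_mem 1 0 4))).
  move=> /= x; rewrite (mem_setof _ ik) => -[u _ <-].
  exists (j (f u)); rewrite sat_fpair_mem (mem_setof _ jl) /=.
  by split; [exists (f u)|apply/(mem_fgraph _ _ ik jl); exists u].
have aF : mem (opair a (app (star M (fgraph i j f)) a)) (star M (fgraph i j f)).
  by have [b []] := tot _ aD; rewrite sat_fpair_mem => _; exact: ex.
split=> //.
(* To keep the quantifiers bounded, the value y is reached as a member of a member w of the pair p;
   below, w is {a, b}. *)
have /(transfer M)/= cod : sat e
    (FAll 2 (FAll 0 (FAll 0 (FAll 3 (FImp (fpair 3 0 1) (FMem 1 5)))))).
  move=> /= p pF w wp y yw x xD; rewrite sat_fpair /= => pE; subst p.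
  move: pF; rewrite (mem_fgraph _ _ ik jl) => -[u /opair_inj[_ <-]].
  by rewrite (mem_setof _ jl); exists (f u).
set b := app _ _ in aF *.
apply: (cod _ aF (setof [set a; b]) _ b _ a aD); last exact/sat_fpair.
  by apply/mem_setof2; right.
by apply/mem_setof2; right.
Qed.

End StarTheory.

(** * Subsets of X and their extensions to *X *)

Section Hull.
Context (R : realType) (X : topologicalType) (S : individuals X R).
Context (V : superstructure S) (K : Type) (M : nonstandard_model V K).
Local Notation star_sub := (Defs.star_sub (M := M)).
Implicit Types (A B : set X) (f : X -> R) (a b : starX M).

Lemma star_sub0 : star_sub set0 = set0.
Proof.
rewrite -subset0 => a /= a0.
have /(transfer M)/= : sat (fun=> subX V set0) (FAll 0 (FNot (FEq 0 0))).
  by move=> x /=; rewrite mem_subX => -[? []].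
by move=> /(_ _ a0)[].
Qed.

(** This is what makes the sets A with a in *A an ultrafilter. Disjointness comes from
    intersections; that A and its complement cover X is transferred. *)
Lemma star_subC A : star_sub (~` A) = ~` star_sub A.
Proof.
have disj : star_sub A `&` star_sub (~` A) = set0.
  by rewrite -star_subI setICr star_sub0.
pose e i : V := nth (subX V A) [:: subX V setT; subX V A; subX V (~` A)] i.
have /(transfer M)/= tot : sat e (FAll 0 (FOr (FMem 0 2) (FMem 0 3))).
  move=> x /=; rewrite !mem_subX => -[y _ <-].
  by have [Ay|Ay] := pselect (A y); [left|right]; exists y.
apply/seteqP; split=> a /= aA.
  by move=> aA'; have : set0 a by rewrite -disj.
by have [//|//] := tot _ (set_mem (valP a)).
Qed.

Lemma star_subS A B : A `<=` B -> star_sub A `<=` star_sub B.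
Proof. by move=> /setIidl <-; rewrite star_subI => a []. Qed.

Lemma star_sub_embX A (x : X) : star_sub A (embX M x) <-> A x.
Proof.
rewrite /star_sub /= star_mem mem_subX.
split=> [[y Ay yx]|Ax]; last by exists x.
by rewrite -(inX_inj (ind_inj yx)).
Qed.

Lemma ptX_level : range (ptX V) `<=` level 0.
Proof. by move=> _ [x _ <-]; exists (inX S x). Qed.

Lemma ptR_level : range (ptR V) `<=` level 0.
Proof. by move=> _ [x _ <-]; exists (inR S x). Qed.

Lemma ptRR_level :
  range (fun rs : R * R => opair (ptR V rs.1) (ptR V rs.2)) `<=` level 2.
Proof.
by move=> _ [[r s] _ <-]; apply: level_opair; apply: ptR_level; eexists.
Qed.

Lemma ptR_inj : injective (ptR V).
Proof. by move=> r s rs; exact: inR_inj (ind_inj rs). Qed.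

Lemma ptX_inj : injective (ptX V).
Proof. by move=> x y xy; exact: inX_inj (ind_inj xy). Qed.

(** * Comparing values of *f by transfer *)

(** [infinitely_close] is this relation for every [eps] of the form 1/n with n positive. *)
Definition close_within (eps : R) (xi eta : starV M) : Prop :=
  mem (opair (app (star M (graph_abs V))
                  (app (star M (graph_sub V)) (opair xi eta)))
             (star M (ptR V eps)))
      (star M (graph_lt V)).

(** The hypothesis on standard points is transferred. The boolean [t] covers both the inequality and
    its failure. *)
Lemma star_close_within f (eps : R) A B (t : bool) :
  (forall x y, A x -> B y -> (`|f x - f y| < eps) = t) ->
  forall a b, star_sub A a -> star_sub B b ->
  (close_within eps (star_fun f a) (star_fun f b) <-> t).
Proof.
move=> fAB.
set F := fgraph (ptX V) (ptR V) f.
pose Rs := setof (range (ptR V)).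
pose Ds := setof (range (fun rs : R * R => opair (ptR V rs.1) (ptR V rs.2))).
pose e i : V := nth Rs [:: subX V A; subX V B; Rs; Ds; F; graph_sub V;
  graph_abs V; graph_lt V; ptR V eps] i.
pose concl := fpair_mem 0 15 14.
(* Formulas have no function terms, so each intermediate value is a variable. From the outside: x in
   A, y in B, u = f x, v = f y, p = (u, v), w = u - v, z = |w|; [concl] says z < eps. *)
have /(transfer M)/= h : sat e
    (FAll 0 (FAll 2 (FAll 4 (FAll 5 (FAll 7 (FAll 7 (FAll 8
      (FImp (fpair_mem 6 4 11) (FImp (fpair_mem 5 3 11) (FImp (fpair 2 4 3)
        (FImp (fpair_mem 2 1 12) (FImp (fpair_mem 1 0 13)
          (if t then concl else FNot concl))))))))))))).
  move=> /= x xA y yB u _ v _ p _ w _ z _.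
  rewrite !sat_fpair_mem sat_fpair /=.
  rewrite !(mem_fgraph _ _ ptX_level ptR_level).
  rewrite (mem_fgraph _ _ ptRR_level ptR_level).
  rewrite (mem_fgraph _ _ ptR_level ptR_level).
  move: xA yB; rewrite !mem_subX => -[x' Ax' <-] [y' By' <-] {x y}.
  move=> [_ /opair_inj[/ptX_inj-> <-]].
  move=> [_ /opair_inj[/ptX_inj-> <-]] ->.
  move=> [[r s] /= /opair_inj[/opair_inj[/ptR_inj-> /ptR_inj->] <-]].
  move=> [_ /opair_inj[/ptR_inj-> <-]].
  have ltE : mem (opair (ptR V `|f x' - f y'|) (ptR V eps)) (graph_lt V) <-> t.
    rewrite -(fAB _ _ Ax' By') (@mem_setof _ _ _ 2).
      split=> [[[r' s'] /= + /opair_inj[/ptR_inj<- /ptR_inj<-]]//|lt].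
      by exists (`|f x' - f y'|, eps).
    by move=> _ [rs _ <-]; apply: ptRR_level; exists rs.
  move: ltE; rewrite /concl.
  by case: (t) => ltE; rewrite /= sat_fpair_mem /= ltE.
move=> a b aA bB.
have aX := set_mem (valP a); have bX := set_mem (valP b).
have [uR aF] := star_app_fgraph f ptX_level ptR_level aX.
have [vR bF] := star_app_fgraph f ptX_level ptR_level bX.
rewrite -/(star_fun f a) -/(star_fun f b) in uR vR aF bF.
(* That any two reals form a pair in R x R is transferred. *)
have pD : mem (opair (star_fun f a) (star_fun f b)) (star M Ds).
  have /(transfer M)/= : sat e (FAll 2 (FAll 3 (FEx 5 (fpair 0 2 1)))).
    move=> /= r + s; rewrite !(mem_setof _ ptR_level) => -[r' _ <-] [s' _ <-].
    exists (opair (ptR V r') (ptR V s')); rewrite sat_fpair /=; split=> //.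
    by apply/(mem_setof _ ptRR_level); exists (r', s').
  by move=> /(_ _ uR _ vR)[p [pD]]; rewrite sat_fpair /= => <-.
have [wR subF] :=
  star_app_fgraph (fun rs => rs.1 - rs.2) ptRR_level ptR_level pD.
have [zR absF] := star_app_fgraph (fun r => `|r|) ptR_level ptR_level wR.
have := h _ aA _ bB _ uR _ vR _ pD _ wR _ zR.
rewrite !sat_fpair_mem sat_fpair /= => /(_ aF bF erefl subF absF).
by rewrite /concl; case: (t) => /=; rewrite sat_fpair_mem.
Qed.


(** * The ultrafilter of a point and standard parts *)

Definition type_over (a : starX M) : set_system X := [set A | star_sub A a].

Global Instance type_over_filter a : ProperFilter (type_over a).
Proof.
split; first by rewrite /type_over /= star_sub0.
split; first by rewrite /type_over /= star_subT.
  by move=> A B; rewrite /type_over /= star_subI.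
by move=> A B AB; exact: star_subS.
Qed.

(* r is the standard part of *f(a). *)
Definition has_shadow f a (r : R) :=
  forall eps, 0 < eps -> star_sub [set x | `|f x - r| < eps] a.

Lemma has_shadow_ex f a : bounded_fun f -> exists r, has_shadow f a r.
Proof.
move=> [N [_ /(_ (N + 1))]]; rewrite ltrDl ltr01 => /(_ isT) fN.
have FI : (f @ type_over a) [set` `[- (N + 1), N + 1]].
  apply: filterS (filterT : type_over a setT) => x _ /=.
  by rewrite in_itv /= -ler_norml; exact: fN.
(* The image filter contains a compact segment, so it clusters at some r. If f were not eps-close to
   r along the ultrafilter, the complement would belong to it, and its image misses the ball around
   r. *)
have [r [_ clr]] := @segment_compact R _ _ _ _ FI.
exists (r : R) => eps eps0.
have [//|] := pselect (star_sub [set x | `|f x - r| < eps] a).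
rewrite -[X in X -> _]/((~` _) a) -star_subC => far.
have [] := clr (f @` [set x | ~ `|f x - r| < eps]) (ball r eps).
- by apply: star_subS far => x fx; exists x.
- exact: nbhsx_ballx.
by move=> _ [[x nfx <-]]; rewrite -ball_normE /= distrC.
Qed.

Lemma has_shadow_unique f a r s : has_shadow f a r -> has_shadow f a s -> r = s.
Proof.
move=> ar as_; apply/eqP/negP => /negP rs.
have d0 : 0 < `|r - s| / 2 by rewrite divr_gt0 ?normr_gt0 ?subr_eq0.
have [x [/= xr xs]] := filter_ex (filterI (ar _ d0 : type_over a _) (as_ _ d0)).
have : `|r - s| < `|r - s|.
  rewrite [ltRHS]splitr (le_lt_trans (ler_distD (f x) _ _))// ltrD//.
  by rewrite distrC.
by rewrite ltxx.
Qed.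

Lemma infinitely_close_shadow f a b r s :
  has_shadow f a r -> has_shadow f b s ->
  infinitely_close (star_fun f a) (star_fun f b) <-> r = s.
Proof.
move=> ar bs; split=> [ab|rs n n0].
  apply/eqP/negP => /negP rs.
  (* Values of f within d of r and of s are more than d apart, hence not within 1/n once 1/n < d;
     this failure is what transfers. *)
  pose d := `|r - s| / 3.
  have d0 : 0 < d by rewrite divr_gt0 ?normr_gt0 ?subr_eq0.
  pose n := (Num.truncn d^-1).+1.
  have nd : n%:R^-1 < d.
    by rewrite invf_plt ?posrE// truncnS_gt.
  have far x y : `|f x - r| < d -> `|f y - s| < d ->
      (`|f x - f y| < n%:R^-1) = false.
    move=> xr ys; apply/negP => /lt_trans/(_ nd) xy.
    have : `|r - s| < d + d + d.
      rewrite (le_lt_trans (ler_distD (f y) _ _))// ltrD//.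
      rewrite (le_lt_trans (ler_distD (f x) _ _))// ltrD//.
      by rewrite distrC.
    by rewrite /d; set z := `|r - s|; lra.
  have [close _] := star_close_within far (ar _ d0) (bs _ d0).
  by have := close (ab n isT).
subst s; have e0 : 0 < n%:R^-1 / 2 :> R by rewrite divr_gt0 ?invr_gt0 ?ltr0n.
have near x y : `|f x - r| < n%:R^-1 / 2 -> `|f y - r| < n%:R^-1 / 2 ->
    (`|f x - f y| < n%:R^-1) = true.
  move=> xr yr; rewrite (splitr n%:R^-1) (le_lt_trans (ler_distD r _ _))//.
  by rewrite ltrD// distrC.
by have [_] := star_close_within near (ar _ e0) (bs _ e0); apply.
Qed.


(** The default 0 is taken only when *f(a) has no standard part, which is excluded for bounded f. *)
Definition shadow f a : R := xget 0 (has_shadow f a).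

Lemma shadowP f a : bounded_fun f -> has_shadow f a (shadow f a).
Proof.
by move=> /(@has_shadow_ex f a); exact: (@xgetPex _ 0 (has_shadow f a)).
Qed.

Lemma shadow_embX f (x : X) : shadow f (embX M x) = f x.
Proof.
have fx : has_shadow f (embX M x) (f x).
  by move=> eps eps0; apply/star_sub_embX; rewrite /= subrr normr0.
apply: (has_shadow_unique _ fx).
by apply: (@xgetPex _ 0 (has_shadow f (embX M x))); exists (f x).
Qed.

(** * The standard topology: continuity of standard parts and compactness *)

Lemma star_sub_open A : open A -> open (star_sub A).
Proof. by move=> oA; exists [set A]; [move=> _ ->|rewrite bigcup_set1]. Qed.

Lemma nbhs_starX a (N : set (starX M)) :
  nbhs a N -> exists A, [/\ open A, star_sub A a & star_sub A `<=` N].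
Proof.
rewrite nbhsE => -[_ [[Ds DsO <-] [A DsA aA]] DsN].
by exists A; split=> [||b bA]; [exact: DsO| |apply: DsN; exists A].
Qed.

Lemma shadow_continuous f : Cb R X f -> continuous (shadow f).
Proof.
move=> [fc fb] a N /nbhs_ballP[eps /= eps0 epsN].
have e2 : 0 < eps / 2 by rewrite divr_gt0.
pose r := shadow f a; pose A := [set x | `|f x - r| < eps / 2].
have oA : open A.
  have -> : A = f @^-1` ball r (eps / 2).
    by apply/seteqP; split=> x; rewrite -ball_normE /= distrC.
  by apply: open_comp => [x _|]; [exact: fc|exact: ball_open].
have aA : star_sub A a by exact: shadowP.
have : nbhs a (star_sub A).
  by apply: open_nbhs_nbhs; split=> //; exact: star_sub_open.
apply: filterS => b bA; apply: epsN; rewrite -ball_normE /=.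
(* A standard x close to both standard parts: f x is within eps/2 of r and of [shadow f b]. *)
have [x [/= xA xb]] :=
  filter_ex (filterI (bA : type_over b _) (shadowP b fb e2)).
rewrite (splitr eps) (le_lt_trans (ler_distD (f x) _ _))// ltrD//.
by rewrite distrC.
Qed.

Lemma compact_starX : @open X #<= [set: K] -> compact [set: starX M].
Proof.
move=> openK F FF _.
(* Indexing by open sets of X bounds the size of the family by that of [K]. *)
pose D := [set A : set X | open A /\ F (~` star_sub A)].
have [c cD] :
    \bigcap_(C in [set star M (subX V (~` A)) | A in D]) members C !=set0.
  apply: (saturation (n := M)).
  - apply: card_le_trans (card_image_le _ _) (card_le_trans _ openK).
    by apply: subset_card_le => A [].
  - move=> _ [A _ <-]; split; last exact: star_internal.
    apply: star_is_set.
    have [|//] := @setofP _ V (ptX V @` ~` A) 0.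
    by move=> _ [x _ <-]; exact: ptX_level.
  (* A finite intersection of these sets traces a member of the proper filter [F] on *X, hence is
     nonempty. *)
  move=> C CD Cfin.
  have /filter_ex[a aC] :
      F (\bigcap_(B in C) [set a : starX M | mem (set_val a) B]).
    apply: filter_finite_bigcap => // B /CD[A [_ FA] <-].
    by rewrite -[X in F X]/(star_sub (~` A)) star_subC.
  by exists (set_val a) => B /aC.
(* The empty set is one of the indices, and it forces c into *X. *)
have cX : mem c (star M (subX V setT)).
  rewrite -setC0; apply: cD; exists set0 => //; split; first exact: open0.
  by rewrite star_sub0 setC0; exact: filterT.
pose a : starX M := exist _ c (mem_set cX).
exists a; split=> // B N FB /nbhs_starX[A [oA aA AN]].
have [//|BN] := pselect (B `&` N !=set0).
(* If [B] missed [N], it would miss *A, so A would be an index and a would avoid *A. *)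
have AD : D A.
  split=> //; apply: filterS FB => b Bb bA; apply: BN; exists b; split=> //.
  exact: AN.
have : star_sub (~` A) a by apply: cD; exists A.
by rewrite star_subC.
Qed.

(** * Equality of points of the hull *)

Lemma hull_map_eq (Phi : set (X -> R)) a b :
  hull_map (M := M) Phi a = hull_map Phi b <-> hull_rel Phi a = hull_rel Phi b.
Proof.
rewrite /hull_map !unlock; split=> [/(congr1 sval)//|ab].
exact/eq_exist.
Qed.

Lemma hull_relP a b : hull_rel (Cb R X) a b <->
  forall f, Cb R X f -> shadow f a = shadow f b.
Proof.
split=> ab f fC; have fb := fC.2; have := ab _ fC;
  by rewrite (infinitely_close_shadow (shadowP a fb) (shadowP b fb)).
Qed.

(** Having equal shadows is visibly an equivalence relation, so two classes coincide exactly when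
    their representatives are related. *)
Lemma hull_map_CbP a b : hull_map (M := M) (Cb R X) a = hull_map (Cb R X) b <->
  forall f, Cb R X f -> shadow f a = shadow f b.
Proof.
rewrite hull_map_eq; split=> [ab|ab].
  apply/hull_relP; rewrite ab; exact/hull_relP.
apply/seteqP; split=> c /hull_relP h; apply/hull_relP => f fC.
  by rewrite -ab// h.
by rewrite ab// h.
Qed.

End Hull.

(** * The universal property of the hull *)

Theorem mainTheorem5 (R : realType) (X : topologicalType)
    (S : individuals X R) (V : superstructure S)
    (K : Type) (K_infinite : infinite_set [set: K])
    (K_gt : @open X #<= [set: K] /\ ~ ([set: K] #<= @open X))
    (M : nonstandard_model V K) :
  stone_cech R (hull_map (Cb R X) \o embX M).
Proof.
set q := hull_map (M := M) (Cb R X).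
have q_surj y : exists a, q a = y by exists (repr y); exact: reprK.
have q_cont : continuous q by exact: pi_continuous.
have emb_cont : continuous (embX M).
  move=> x N /nbhs_starX[A [oA /star_sub_embX Ax AN]].
  apply: (filterS (P := A)); last exact: open_nbhs_nbhs.
  by move=> y Ay; apply/AN/star_sub_embX.
have ext f : Cb R X f ->
    exists2 g : hull M (Cb R X) -> R, continuous g & g \o q = shadow f.
  move=> fC.
  (* The shadow is constant on classes, so it may be read at the chosen representative. *)
  have gE : (shadow f \o repr) \o q = shadow f.
    apply/funext => a /=.
    have /hull_map_CbP : q (repr (q a)) = q a by exact: reprK.
    exact.
  exists (shadow f \o repr) => //.
  apply/quotient_continuous.
  rewrite -[_ \o _]/((shadow f \o repr) \o q) gE.
  exact: shadow_continuous.
have q_dense : dense (range (q \o embX M)).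
  move=> O [y Oy] oO.
  have [a qa] := q_surj y.
  have : nbhs a (q @^-1` O).
    by apply: q_cont; apply: open_nbhs_nbhs; rewrite qa.
  (* The preimage of [O] contains some *A with a in *A; such an A has a standard point. *)
  move=> /nbhs_starX[A [_ aA AO]].
  have [x Ax] := filter_ex (aA : type_over a A).
  by exists (q (embX M x)); split; [apply/AO/star_sub_embX|exists x].
split=> //.
- have -> : [set: hull M (Cb R X)] = q @` setT.
    by apply/seteqP; split=> // y _; have [a <-] := q_surj y; exists a.
  apply: continuous_compact; last exact: compact_starX K_gt.1.
  exact: continuous_subspaceT.
(* If y and z have no disjoint neighbourhoods, every continuous real function agrees on them; the
   extensions then give equal shadows, so y = z. *)
- move=> y z yz; have [a qa] := q_surj y; have [b qb] := q_surj z.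
  subst y z; apply/hull_map_CbP => f fC; have [g gc gE] := ext f fC.
  rewrite -gE /=; apply: (@norm_hausdorff R R^o) => U W gU gW.
  have [c [Uc Wc]] := yz _ _ (gc _ _ gU) (gc _ _ gW).
  by exists (g c).
- by move=> x; apply: continuous_comp; [exact: emb_cont|exact: q_cont].
move=> f fC; have [g gc gE] := ext f fC.
exists g; split.
  split=> //; apply/funext => x.
  by rewrite -[f x](shadow_embX M) -gE.
move=> h [hc hf].
apply: (dense_continuous_eq (@norm_hausdorff R R^o) q_dense gc hc).
by move=> _ [x _ <-]; rewrite -[g _]/((g \o q) _) gE shadow_embX -hf.
Qed.
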